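(* Let $s\ge1$, $L\ge1$, widths $d_0=s,d_1,\dots,d_{L+1}$, matrices $W_\ell\in\mathbb{R}^{d_{\ell+1}\times d_\ell}$ and vectors $\mathbf{v}_\ell\in\mathbb{R}^{d_{\ell+1}}$ ($\ell=0,\dots,L$), and a smooth $\sigma:\mathbb{R}\to\mathbb{R}$ applied componentwise. Suppose there are positive sequences $(\beta_j)_{j\ge1}$, $(R_\ell)_{\ell\ge1}$ and constants $\xi>0,\tau>0$ such that $\max_{1\le p\le d_1}|W_{0,p,j}|\le\beta_j$ for $j=1,\dots,s$, $\|W_\ell\|_\infty:=\max_p\sum_q|W_{\ell,p,q}|\le R_\ell$ for $\ell\ge1$, and $\sup_{x\in\mathbb{R}}|\sigma^{(n)}(x)|\le A_n:=\xi\,\tau^n\,n!$ for all $n\ge1$. Define $P_0:=1$, $P_k:=\prod_{t=1}^k(\xi\tau R_t)$ for $k\ge1$, $S_\ell:=\tau\sum_{k=0}^{\ell-1}P_k$, and $C_\ell:=\max\{\|G^{[\ell]}_\theta\|_\infty,\,P_\ell/S_\ell\}$, where $\|G^{[\ell]}_\theta\|_\infty:=\sup_{\mathbf{y}\in[0,1]^s}\max_p|G^{[\ell]}_\theta(\mathbf{y})_p|$. Then for every $1\le\ell\le L$, every component $1\le p\le d_{\ell+1}$, every multiindex $\boldsymbol{\nu}\in\mathbb{N}_0^s$ (including $\boldsymbol{\nu}=\mathbf{0}$) and every $\mathbf{y}\in[0,1]^s$: (a) the non-periodic network $G^{[0]}_\theta(\mathbf{y}):=W_0\mathbf{y}+\mathbf{v}_0$,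 $G^{[\ell]}_\theta(\mathbf{y}):=W_\ell\sigma(G^{[\ell-1]}_\theta(\mathbf{y}))+\mathbf{v}_\ell$ satisfies $$|\partial^{\boldsymbol{\nu}}G^{[\ell]}_\theta(\mathbf{y})_p|\le C_\ell\,|\boldsymbol{\nu}|!\,(S_\ell\boldsymbol{\beta})^{\boldsymbol{\nu}};$$ (b) the periodic network $G^{[0]}_\theta(\mathbf{y}):=W_0\sin(2\pi\mathbf{y})+\mathbf{v}_0$, $G^{[\ell]}_\theta(\mathbf{y}):=W_\ell\sigma(G^{[\ell-1]}_\theta(\mathbf{y}))+\mathbf{v}_\ell$ satisfies $$|\partial^{\boldsymbol{\nu}}G^{[\ell]}_\theta(\mathbf{y})_p|\le C_\ell\,(2\pi)^{|\boldsymbol{\nu}|}\sum_{\mathbf{m}\le\boldsymbol{\nu}}|\mathbf{m}|!\,(S_\ell\boldsymbol{\beta})^{\mathbf{m}}\,\mathcal{S}(\boldsymbol{\nu},\mathbf{m}).$$ (Here $C_\ell$ is defined with respect to the respective network.)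
   Context: For $\boldsymbol{\nu}\in\mathbb{N}_0^s$: $|\boldsymbol{\nu}|=\sum_j\nu_j$, $\partial^{\boldsymbol{\nu}}=\prod_j(\partial/\partial y_j)^{\nu_j}$, $(S\boldsymbol{\beta})^{\boldsymbol{\nu}}=\prod_j(S\beta_j)^{\nu_j}$, $\mathbf{m}\le\boldsymbol{\nu}$ componentwise. $\mathcal{S}(n,k)$ is the Stirling number of the second kind ($\mathcal{S}(n,0)=\delta_{n,0}$, $\mathcal{S}(n,k)=0$ for $k>n$, $\mathcal{S}(n,k)=\frac1{k!}\sum_{i=0}^k(-1)^{k-i}\binom ki i^n$ for $n\ge k$), and $\mathcal{S}(\boldsymbol{\nu},\mathbf{m})=\prod_j\mathcal{S}(\nu_j,m_j)$. The sine is applied componentwise. *)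

(* Defs.v *)
From HB Require Import structures.
From mathcomp Require Import all_boot all_order all_algebra.
From mathcomp Require Import all_classical all_reals all_analysis.
Set Implicit Arguments. Unset Strict Implicit. Unset Printing Implicit Defensive.
Import Order.TTheory GRing.Theory Num.Theory.
Import numFieldNormedType.Exports.
Local Open Scope classical_set_scope.
Local Open Scope ring_scope.

Section Defs.
Variable R : realType.

(* Stirling number of the second kind, by the explicit formula of the paper;
   S(n,k) = 0 for k > n (for k = 0 the formula gives delta_{n,0}). *)
Definition stirling2 (n k : nat) : R :=
  if (k <= n)%N then
    (k`!%:R)^-1 * \sum_(i < k.+1) (-1) ^+ (k - i) * 'C(k, i)%:R * (i%:R) ^+ n
  else 0.

Definition pderiv (s : nat) (j : 'I_s) (f : ('I_s -> R) -> R) : ('I_s -> R) -> R :=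
  fun y => derive1 (fun t => f (fun k => if k == j then t else y k)) (y j).

Definition pderivn (s : nat) (nu : 'I_s -> nat) (f : ('I_s -> R) -> R) :=
  foldr (fun j g => iter (nu j) (pderiv j) g) f (enum 'I_s).

Definition mabs (s : nat) (nu : 'I_s -> nat) : nat := (\sum_(j < s) nu j)%N.

Definition mpow (s : nat) (c : R) (beta : nat -> R) (nu : 'I_s -> nat) : R :=
  \prod_(j < s) (c * beta j) ^+ nu j.

Definition mstirling (s : nat) (nu m : 'I_s -> nat) : R :=
  \prod_(j < s) stirling2 (nu j) (m j).

(* Network: layer l, input y in R^s, output component p (0-based).
   Layer 0: G0(y)_p = sum_q W_{0,p,q} inp(y_q) + v_{0,p}, where inp = id
   (non-periodic) or inp = sin(2 pi .) (periodic).
   Layer l+1: G(y)_p = sum_{q < d_{l+1}} W_{l+1,p,q} sigma(G^[l](y)_q) + v_{l+1,p}.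
   Widths d : nat -> nat, matrix W l : d(l+1) x d l given by W l p q. *)
Local Unset Implicit Arguments.
Fixpoint net (inp : R -> R) (sigma : R -> R) (s : nat) (d : nat -> nat)
  (W : nat -> nat -> nat -> R) (v : nat -> nat -> R) (l : nat)
  (y : 'I_s -> R) (p : nat) : R :=
  match l with
  | 0 => \sum_(q < s) W 0%N p q * inp (y q) + v 0%N p
  | l'.+1 => \sum_(q < d l) W l p q * sigma (net inp sigma s d W v l' y q) + v l p
  end.

Definition unit_cube (s : nat) : set ('I_s -> R) := [set y | forall j, 0 <= y j <= 1].

Local Set Implicit Arguments.

Definition net_sup (inp sigma : R -> R) (s : nat) (d : nat -> nat)
  (W : nat -> nat -> nat -> R) (v : nat -> nat -> R) (l : nat) : R :=
  sup [set `|net inp sigma s d W v l y p| | y in unit_cube s & p in [set p : nat | (p < d l.+1)%N]].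

Definition Pk (xi tau : R) (Rl : nat -> R) (k : nat) : R :=
  \prod_(1 <= t < k.+1) (xi * tau * Rl t).

Definition Sl (xi tau : R) (Rl : nat -> R) (l : nat) : R :=
  tau * \sum_(0 <= k < l) Pk xi tau Rl k.

Definition Cl (inp sigma : R -> R) (s : nat) (d : nat -> nat)
  (W : nat -> nat -> nat -> R) (v : nat -> nat -> R) (xi tau : R) (Rl : nat -> R)
  (l : nat) : R :=
  Num.max (net_sup inp sigma s d W v l) (Pk xi tau Rl l / Sl xi tau Rl l).

End Defs.

(* Main.v *)
(** Iterated partial derivatives are compared with those of a majorant that
    depends on [y] only through [t = sum_j beta_j y_j], so that the chain and
    product rules become identities between one-variable power series.  If the
    first derivatives of layer [l] are dominated by those of
    [u = P t / (1 - S t)], then those of [sigma] applied to it are dominated by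
    those of [xi / (1 - tau u)], and up to a constant this is
    [xi tau P t / (1 - (S + tau P) t)]; with [P = P_l] and [S = S_l] the
    recursion [S_(l+1) = S_l + tau P_l], [P_(l+1) = xi tau R_(l+1) P_l] appears,
    and [u] has coefficients [(P_l / S_l) S_l^n] for [n >= 1].  Only [nu = 0]
    needs the supremum in [C_l].
    The periodic network is the non-periodic one evaluated at [sin (2 pi y)].
    Each differentiation in [y_j] either hits one of the [m_j] sinusoids in
    [y_j] present or raises the order [m_j] of the outer derivative, which is the
    recursion [S(n+1,k) = k S(n,k) + S(n,k-1)] of the Stirling numbers. *)

Require Import Defs.
From HB Require Import structures.
From mathcomp Require Import all_boot all_order all_algebra.
From mathcomp Require Import all_classical all_reals all_analysis.
From mathcomp Require Import ring.
Set Implicit Arguments. Unset Strict Implicit. Unset Printing Implicit Defensive.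
Import Order.TTheory GRing.Theory Num.Theory.
Import numFieldNormedType.Exports.
Local Open Scope classical_set_scope.
Local Open Scope ring_scope.

(** * Exponential generating functions *)

(* [a n] is the [n]-th derivative at [0], i.e. [n!] times the coefficient of
   [t^n]: differentiation is the shift [dseq], and the product is defined by
   the Leibniz rule. *)
Definition egf (R : realType) : Type := nat -> R.
HB.instance Definition _ (R : realType) := GRing.Zmodule.copy (egf R) (nat -> R).

Definition dseq {R : realType} (a : egf R) : egf R := fun n => a n.+1.

Fixpoint egf_mul {R : realType} (a b : egf R) (n : nat) : R :=
  if n is n'.+1 then egf_mul (dseq a) b n' + egf_mul a (dseq b) n' else a 0%N * b 0%N.

Definition egf_cst {R : realType} (c : R) : egf R := fun n => if n is 0%N then c else 0.

Lemma egfP {R : realType} (a b : egf R) : (forall n, a n = b n) -> a = b.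
Proof. by move=> ab; apply/funext. Qed.

Lemma egfDE {R : realType} (a b : egf R) n : (a + b) n = a n + b n.
Proof. by []. Qed.

Lemma egfNE {R : realType} (a : egf R) n : (- a) n = - a n.
Proof. by []. Qed.

Lemma dseqD {R : realType} (a b : egf R) : dseq (a + b) = dseq a + dseq b.
Proof. by []. Qed.

Lemma dseq_egf_mul {R : realType} (a b : egf R) :
  dseq (egf_mul a b) = (egf_mul (dseq a) b : egf R) + (egf_mul a (dseq b) : egf R).
Proof. by []. Qed.

Lemma egf_mulC {R : realType} : commutative (@egf_mul R).
Proof.
move=> a b; apply: egfP => n.
by elim: n a b => [|n IH] a b /=; [rewrite mulrC | rewrite addrC !(IH _ b) !(IH _ (dseq b))].
Qed.

Lemma egf_mulDl {R : realType} : left_distributive (@egf_mul R) +%R.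
Proof.
move=> a b c; apply: egfP => n; rewrite egfDE.
elim: n a b c => [|n IH] a b c /=; first by rewrite mulrDl.
by rewrite dseqD !IH addrACA.
Qed.

Lemma egf_mulA {R : realType} : associative (@egf_mul R).
Proof.
have mulDr (a b c : egf R) : egf_mul a (b + c) = (egf_mul a b : egf R) + egf_mul a c.
  by rewrite !(egf_mulC a) egf_mulDl.
move=> a b c; apply: egfP => n.
elim: n a b c => [|n IH] a b c /=; first by rewrite mulrA.
by rewrite !dseq_egf_mul egf_mulDl mulDr !egfDE !IH addrA.
Qed.

Lemma egf_cst_mulE {R : realType} (c : R) (a : egf R) n : egf_mul (egf_cst c) a n = c * a n.
Proof.
have mul0 : forall (b : egf R) m, egf_mul (fun=> 0) b m = 0.
  by move=> b m; elim: m b => [|m IH] b /=; rewrite ?mul0r// !IH addr0.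
by elim: n a => [//|n IH] a /=; rewrite IH [X in X + _]mul0 add0r.
Qed.

Lemma egf_mul1 {R : realType} : left_id (egf_cst 1) (@egf_mul R).
Proof. by move=> a; apply: egfP => n; rewrite egf_cst_mulE mul1r. Qed.

Lemma egf_1neq0 {R : realType} : (egf_cst 1 : egf R) != 0.
Proof. by apply/eqP => /(congr1 (@^~ 0%N)) /eqP; rewrite oner_eq0. Qed.

HB.instance Definition _ (R : realType) :=
  GRing.Zmodule_isComNzRing.Build (egf R) egf_mulA egf_mulC egf_mul1 egf_mulDl egf_1neq0.

Lemma dseqM {R : realType} (a b : egf R) : dseq (a * b) = dseq a * b + a * dseq b.
Proof. by []. Qed.

Lemma egfM0 {R : realType} (a b : egf R) : (a * b) 0%N = a 0%N * b 0%N.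
Proof. by []. Qed.

Lemma egfX0 {R : realType} (a : egf R) k : (a ^+ k) 0%N = a 0%N ^+ k.
Proof. by elim: k => [|k IH] //; rewrite !exprS egfM0 IH. Qed.

Lemma egf_cstM {R : realType} (c : R) (a : egf R) n : (egf_cst c * a) n = c * a n.
Proof. exact: egf_cst_mulE. Qed.

Lemma dseqX {R : realType} (a : egf R) k : dseq (a ^+ k.+1) = a ^+ k * dseq a *+ k.+1.
Proof.
elim: k => [|k IH]; first by rewrite expr1 expr0 mul1r.
by rewrite exprS dseqM IH (mulrS _ k.+1) mulrnAr mulrA -!exprS (mulrC (dseq a)).
Qed.

Lemma egf_cstD {R : realType} (c d : R) : egf_cst (c + d) = egf_cst c + egf_cst d.
Proof. by apply: egfP => -[|n]; rewrite egfDE /= ?addr0. Qed.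

Lemma egf_mulrn {R : realType} (a : egf R) n : a *+ n = egf_cst n%:R * a.
Proof.
elim: n => [|n IH]; first by apply: egfP => m; rewrite egf_cstM mul0r.
by rewrite mulrSr IH -natr1 egf_cstD mulrDl mul1r.
Qed.

Lemma dseq_cst {R : realType} (c : R) : dseq (egf_cst c) = 0.
Proof. by []. Qed.

Definition egf_X {R : realType} : egf R := fun n => (n == 1%N)%:R.

Lemma dseq_X {R : realType} : dseq egf_X = 1 :> egf R.
Proof. by apply: egfP => -[]. Qed.

(** The factor [n] is the ratio of [n!] to [(n-1)!] in this normalisation; it vanishes at [n = 0],
    where [n.-1] is again [0]. *)
Lemma egf_XM {R : realType} (a : egf R) n : (egf_X * a) n = n%:R * a n.-1.
Proof.
elim: n a => [|n IH] a; first by rewrite egfM0 /egf_X !mul0r.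
rewrite -[LHS]/(dseq (egf_X * a) n) dseqM dseq_X mul1r egfDE IH /dseq.
by case: n {IH} => [|n] /=; rewrite ?mul0r ?addr0 ?mul1r// -[n.+2]add1n natrD; ring.
Qed.

(* The series [1 - S t], [1 / (1 - S t)] and [(1 - S t) / (1 - T t)]. *)
Definition egf_line {R : realType} (S : R) : egf R := 1 - egf_cst S * egf_X.

Definition egf_geom {R : realType} (S : R) : egf R := fun n => n`!%:R * S ^+ n.

Lemma egf_lineM {R : realType} (S : R) (a : egf R) n :
  (egf_line S * a) n = a n - n%:R * S * a n.-1.
Proof.
rewrite /egf_line mulrBl mul1r -[X in - X]mulrA egfDE egfNE.
by rewrite egf_cstM egf_XM mulrCA mulrA.
Qed.

Lemma egf_line_geom {R : realType} (S : R) : egf_line S * egf_geom S = 1.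
Proof.
apply: egfP => n; rewrite egf_lineM /egf_geom; case: n => [|n] /=.
  by rewrite !mul0r subr0 fact0 mul1r.
by rewrite [RHS]/(egf_cst 1 n.+1) /= factS natrM exprS; ring.
Qed.

Lemma dseq_line {R : realType} (S : R) : dseq (egf_line S) = - egf_cst S.
Proof.
rewrite -[RHS]mulr1 -dseq_X; apply: egfP => n.
have -> : dseq (egf_line S) = dseq 1 - dseq (egf_cst S * egf_X) by [].
by rewrite -[1]/(egf_cst 1) dseqM !dseq_cst mul0r !add0r mulNr.
Qed.

(** Differentiating [(1 - S t) * egf_geom S = 1] and multiplying by [egf_geom S] gives this without
    any convolution sum. *)
Lemma dseq_geom {R : realType} (S : R) : dseq (egf_geom S) = egf_cst S * egf_geom S ^+ 2.
Proof.
have l1 := egf_line_geom S; have /(congr1 dseq) := l1.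
rewrite -[1]/(egf_cst 1) dseq_cst dseqM dseq_line.
move=> /(congr1 (fun u => u * egf_geom S)); rewrite mul0r mulrDl => l2.
have e : dseq (egf_geom S) = egf_line S * dseq (egf_geom S) * egf_geom S.
  by rewrite mulrAC l1 mul1r.
by rewrite e; apply: subr0_eq; rewrite -l2; ring.
Qed.

(** As [1 - S t] is invertible, it is enough that the right-hand side multiplied by it is
    [egf_geom S], a two-term check on each coefficient. *)
Lemma egf_geom2E {R : realType} (S : R) n : (egf_geom S ^+ 2) n = n.+1`!%:R * S ^+ n.
Proof.
pose b : egf R := fun n => n.+1`!%:R * S ^+ n.
suff e : egf_line S * b = egf_geom S.
  suff -> : egf_geom S ^+ 2 = b by [].
  by rewrite -[RHS]mul1r -(egf_line_geom S) -mulrA (mulrC _ b) mulrA e.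
apply: egfP => m; rewrite egf_lineM /b /egf_geom; case: m => [|m] /=.
  by rewrite !mul0r subr0.
by rewrite (factS m.+1) natrM -[m.+2]add1n natrD exprS; ring.
Qed.

Definition egf_ratio {R : realType} (S T : R) : egf R := egf_line S * egf_geom T.

(** In the quotient rule the numerator [(S + c) (1 - S t) - S (1 - (S + c) t)] collapses to the
    constant [c]. *)
Lemma dseq_ratio {R : realType} (S c : R) :
  dseq (egf_ratio S (S + c)) = egf_cst c * egf_geom (S + c) ^+ 2.
Proof.
rewrite /egf_ratio; set z := egf_geom _; have l1 : egf_line (S + c) * z = 1 by exact: egf_line_geom.
rewrite dseqM dseq_line dseq_geom -/z -[X in - _ * X]mul1r -l1.
by rewrite /egf_line egf_cstD; ring.
Qed.

Lemma egf_ratio_geom {R : realType} (S T : R) : egf_ratio S T * egf_geom S = egf_geom T.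
Proof. by rewrite /egf_ratio mulrAC egf_line_geom mul1r. Qed.

Lemma egf_ratio0 {R : realType} (S T : R) : egf_ratio S T 0%N = 1.
Proof. by rewrite /egf_ratio egf_lineM !mul0r subr0 /egf_geom fact0 mul1r expr0. Qed.

(** * Majorants of iterated partial derivatives *)

(** A relation, so that it carries the existence of the derivative, which the total function
    [pderiv] does not and which the sum, product and chain rules require. *)
Definition is_pderiv {R : realType} {s : nat} (j : 'I_s) (f g : ('I_s -> R) -> R) :=
  forall y : 'I_s -> R, is_derive (y j) (1 : R)
    (fun t : R => f (fun k => if k == j then t else y k)) (g y).

Lemma upd_id {R : realType} {s : nat} (j : 'I_s) (y : 'I_s -> R) :
  (fun k => if k == j then y j else y k) = y.
Proof. by apply/funext => k; case: eqP => [->|]. Qed.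

Lemma is_pderivE {R : realType} {s : nat} (j : 'I_s) (f g : ('I_s -> R) -> R) :
  is_pderiv j f g -> pderiv j f = g.
Proof. by move=> fg; apply/funext => y; rewrite /pderiv derive1E; apply: derive_val. Qed.

Lemma is_pderivM {R : realType} {s : nat} (j : 'I_s) (f f' g g' : ('I_s -> R) -> R) :
  is_pderiv j f f' -> is_pderiv j g g' ->
  is_pderiv j (fun y => f y * g y) (fun y => f' y * g y + f y * g' y).
Proof.
move=> ff gg y; have := is_deriveM (ff y) (gg y).
by rewrite upd_id => h; apply: is_derive_eq; rewrite addrC [X in X + _]mulrC.
Qed.

Lemma is_pderivD {R : realType} {s : nat} (j : 'I_s) (f f' g g' : ('I_s -> R) -> R) :
  is_pderiv j f f' -> is_pderiv j g g' ->
  is_pderiv j (fun y => f y + g y) (fun y => f' y + g' y).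
Proof. by move=> ff gg y; apply: is_deriveD. Qed.

Lemma is_pderiv_cst {R : realType} {s : nat} (j : 'I_s) (c : R) :
  is_pderiv j (fun=> c) (fun=> 0).
Proof. by move=> y; apply: is_derive_cst. Qed.

Lemma is_pderiv_sum {R : realType} {s : nat} (j : 'I_s) (d : nat) (c : 'I_d -> R)
    (f f' : 'I_d -> ('I_s -> R) -> R) :
  (forall q, is_pderiv j (f q) (f' q)) ->
  is_pderiv j (fun y => \sum_(q < d) c q * f q y) (fun y => \sum_(q < d) c q * f' q y).
Proof.
elim: d c f f' => [|d IH] c f f' ff.
  have e (h : 'I_0 -> ('I_s -> R) -> R) : (fun y => \sum_(q < 0) c q * h q y) = fun=> 0.
    by apply/funext => y; rewrite big_ord0.
  by rewrite !e; apply: is_pderiv_cst.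
have e (h : 'I_d.+1 -> ('I_s -> R) -> R) : (fun y => \sum_(q < d.+1) c q * h q y) =
   fun y => c ord0 * h ord0 y + \sum_(q < d) c (lift ord0 q) * h (lift ord0 q) y.
  by apply/funext => y; rewrite big_ord_recl.
rewrite !e; apply: is_pderivD; last by apply: IH.
move=> y; have := is_pderivM (is_pderiv_cst j (c ord0)) (ff ord0) y.
by rewrite mul0r add0r.
Qed.

Lemma is_pderiv_comp {R : realType} {s : nat} (j : 'I_s) (f f' : ('I_s -> R) -> R)
    (h h' : R -> R) :
  (forall x : R, is_derive x (1 : R) h (h' x)) -> is_pderiv j f f' ->
  is_pderiv j (fun y => h (f y)) (fun y => h' (f y) * f' y).
Proof.
move=> hh ff y; have := @is_derive1_comp R h _ (y j) _ _ (hh _) (ff y).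
by rewrite upd_id.
Qed.

Lemma is_pderiv_coord {R : realType} {s : nat} (j q : 'I_s) :
  is_pderiv j (fun y : 'I_s -> R => y q) (fun=> (q == j)%:R).
Proof.
move=> y; case: eqP => _ /=; [exact: is_derive_id | exact: is_derive_cst].
Qed.

(* [M] bounds the iterated partial derivatives of order [< n] of [f], the
   directions being listed in [w] in the order in which they are applied. *)
Fixpoint majn {R : realType} {s : nat} (n : nat) (f : ('I_s -> R) -> R) (M : seq 'I_s -> R) :=
  if n is n'.+1 then
    (forall y, `|f y| <= M [::]) /\
    forall j, exists2 g, is_pderiv j f g & majn n' g (fun w => M (j :: w))
  else True.

Lemma majn_le {R : realType} {s : nat} n (f : ('I_s -> R) -> R) M N :
  (forall w, M w <= N w) -> majn n f M -> majn n f N.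
Proof.
elim: n f M N => [//|n IH] f M N MN [f0 fj]; split=> [y|j]; first exact: le_trans (MN _).
have [g fg gM] := fj j; exists g => //; exact: IH gM.
Qed.

Lemma majnW {R : realType} {s : nat} n (f : ('I_s -> R) -> R) M : majn n.+1 f M -> majn n f M.
Proof.
elim: n f M => [//|n IH] f M [f0 fj]; split=> // j.
have [g fg gM] := fj j; exists g => //; exact: IH.
Qed.

Lemma majn_foldl {R : realType} {s : nat} w (f : ('I_s -> R) -> R) M :
  majn (size w).+1 f M -> forall y, `|foldl (fun g j => pderiv j g) f w y| <= M w.
Proof.
elim: w f M => [|j w IH] f M [f0 fj] // y.
have [g fg gM] := fj j; rewrite /= (is_pderivE fg).
exact: (IH _ _ gM).
Qed.

Lemma majn_add {R : realType} {s : nat} n (f g : ('I_s -> R) -> R) M N :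
  majn n f M -> majn n g N -> majn n (fun y => f y + g y) (fun w => M w + N w).
Proof.
elim: n f g M N => [//|n IH] f g M N [f0 fj] [g0 gj]; split=> [y|j].
  by apply: le_trans (ler_normD _ _) _; apply: lerD.
have [f' ff fM] := fj j; have [g' gg gM] := gj j.
by exists (fun y => f' y + g' y); [exact: is_pderivD | exact: IH].
Qed.

Lemma majn_cst {R : realType} {s : nat} n (c : R) (M : seq 'I_s -> R) :
  `|c| <= M [::] -> (forall w, 0 <= M w) -> majn n (fun=> c) M.
Proof.
elim: n c M => [//|n IH] c M cM M0; split=> // j.
by exists (fun=> 0); [exact: is_pderiv_cst | apply: IH; rewrite ?normr0].
Qed.

Lemma majn_sum {R : realType} {s : nat} n d (c : 'I_d -> R) (f : 'I_d -> ('I_s -> R) -> R) M C :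
  (forall q, majn n (f q) M) -> \sum_(q < d) `|c q| <= C -> (forall w, 0 <= M w) ->
  majn n (fun y => \sum_(q < d) c q * f q y) (fun w => C * M w).
Proof.
elim: n f M => [//|n IH] f M fM cC M0; split=> [y|j].
  apply: le_trans (ler_norm_sum _ _ _) _.
  apply: le_trans (ler_wpM2r (M0 _) cC); rewrite mulr_suml; apply: ler_sum => q _.
  by rewrite normrM ler_wpM2l//; have [->] := fM q.
have fj q : exists g, is_pderiv j (f q) g /\ majn n g (fun w => M (j :: w)).
  by have [_ /(_ j)[g fg gM]] := fM q; exists g.
have [g gP] := choice fj.
exists (fun y => \sum_(q < d) c q * g q y).
  by apply: is_pderiv_sum => q; have [] := gP q.
by apply: IH => // q; have [] := gP q.
Qed.

(** If [a] lists the derivatives of [A] at [0], this is the derivative at the origin, along the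
    directions [w], of [y] mapped to [A (sum_j beta_j y_j)]. *)
Definition wt {R : realType} {s : nat} (beta : 'I_s -> R) (a : egf R) (w : seq 'I_s) : R :=
  \prod_(j <- w) beta j * a (size w).

Lemma wt_cons {R : realType} {s : nat} (beta : 'I_s -> R) (a : egf R) j w :
  wt beta a (j :: w) = beta j * wt beta (dseq a) w.
Proof. by rewrite /wt big_cons mulrA. Qed.

Lemma wtD {R : realType} {s : nat} (beta : 'I_s -> R) (a b : egf R) w :
  wt beta (a + b) w = wt beta a w + wt beta b w.
Proof. by rewrite /wt egfDE mulrDr. Qed.

Lemma wtZ {R : realType} {s : nat} (beta : 'I_s -> R) c (a : egf R) w :
  wt beta (egf_cst c * a) w = c * wt beta a w.
Proof. by rewrite /wt egf_cstM mulrCA. Qed.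

(** The Leibniz rule for functions matches [dseqM] for series. The constants [c] and [d] are kept
    apart from the series so that they can absorb the [beta j] released by each differentiation. *)
Lemma majn_mul {R : realType} {s : nat} n (beta : 'I_s -> R) (f g : ('I_s -> R) -> R) a b c d :
  majn n f (fun w => c * wt beta a w) -> majn n g (fun w => d * wt beta b w) ->
  majn n (fun y => f y * g y) (fun w => c * d * wt beta (a * b) w).
Proof.
elim: n f g a b c d => [//|n IH] f g a b c d fM gM.
have := (majnW fM, majnW gM); case: fM gM => f0 fj [g0 gj] [fM gM].
split=> [y|j].
  rewrite normrM /wt big_nil mul1r egfM0 mulrACA; apply: ler_pM => //.
    by apply: le_trans (f0 y) _; rewrite /wt big_nil mul1r.
  by apply: le_trans (g0 y) _; rewrite /wt big_nil mul1r.
have [f' ff fM'] := fj j; have [g' gg gM'] := gj j.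
exists (fun y => f' y * g y + f y * g' y); first exact: is_pderivM.
have h1 : majn n f' (fun w => c * beta j * wt beta (dseq a) w).
  by apply: majn_le fM' => w; rewrite wt_cons mulrA.
have h2 : majn n g' (fun w => d * beta j * wt beta (dseq b) w).
  by apply: majn_le gM' => w; rewrite wt_cons mulrA.
apply: majn_le (majn_add (IH _ _ _ _ _ _ h1 gM) (IH _ _ _ _ _ _ fM h2)) => w.
by rewrite wt_cons dseqM wtD le_eqVlt; apply/orP; left; apply/eqP; ring.
Qed.

(* The derivatives of [sigma] of order [>= k] are dominated by those of
   [xi * tau^k * k! / (1 - tau u)^(k+1)], and substituting
   [u = P t / (1 - S t)] turns [1 / (1 - tau u)] into [egf_ratio S (S + tau * P)]. *)
Lemma majn_comp {R : realType} {s : nat} (beta : 'I_s -> R) (sg : nat -> R -> R)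
    (xi tau P S : R) (f : ('I_s -> R) -> R) n k :
  (forall k (x : R), is_derive x (1 : R) (sg k) (sg k.+1 x)) ->
  (forall k x, (1 <= k)%N -> `|sg k x| <= xi * tau ^+ k * k`!%:R) ->
  (forall j, exists2 g, is_pderiv j f g &
      majn n g (fun w => beta j * P * wt beta (egf_geom S ^+ 2) w)) ->
  (1 <= k)%N ->
  majn n (fun y => sg k (f y))
    (fun w => xi * tau ^+ k * k`!%:R * wt beta (egf_ratio S (S + tau * P) ^+ k.+1) w).
Proof.
move=> dsg bsg; elim: n k => [//|n IH] k fj k1; split=> [y|j].
  by rewrite /wt big_nil mul1r egfX0 egf_ratio0 expr1n mulr1 bsg.
have [g fg gM] := fj j; exists (fun y => sg k.+1 (f y) * g y).
  exact: (is_pderiv_comp (dsg k) fg).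
have fj' i : exists2 g, is_pderiv i f g &
    majn n g (fun w => beta i * P * wt beta (egf_geom S ^+ 2) w).
  by have [h fh hM] := fj i; exists h => //; exact: majnW.
(* The chain rule produces [sg k.+1], hence the induction over [n] for all [k]; [f] enters only
   through its first derivatives, so its own size is irrelevant. *)
apply: majn_le (majn_mul (IH k.+1 fj' isT) (majnW gM)) => w.
rewrite wt_cons dseqX dseq_ratio.
have := egf_ratio_geom S (S + tau * P).
move: (egf_ratio S (S + tau * P)) (egf_geom (S + tau * P)) => r z rz.
(* The squared geometric series of [u'] turns two factors [r] into [z], which is exactly the shape
   of the derivative of [r ^+ k.+1]. *)
have -> : r ^+ k.+2 * egf_geom S ^+ 2 = r ^+ k * z ^+ 2.
  by rewrite -rz exprMn -(addn2 k) exprD -mulrA.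
rewrite egf_mulrn (mulrCA (r ^+ k) (egf_cst _) (z ^+ 2)).
rewrite !wtZ factS natrM (exprS tau) le_eqVlt; apply/orP; left; apply/eqP; ring.
Qed.

Lemma majn_scale {R : realType} {s : nat} n (c : R) (f : ('I_s -> R) -> R) M :
  0 <= c -> majn n f M -> majn n (fun y => c * f y) (fun w => c * M w).
Proof.
move=> c0; elim: n f M => [//|n IH] f M [f0 fj]; split=> [y|j].
  by rewrite normrM ger0_norm// ler_wpM2l.
have [g fg gM] := fj j; exists (fun y => c * g y); last exact: IH.
by move=> y; have := is_pderivM (is_pderiv_cst j c) fg y; rewrite mul0r add0r.
Qed.

(** Used for the sum over [trig_var j e], whose length is the number of sinusoids in [y_j]. *)
Lemma majn_sum_seq {R : realType} {s : nat} {T : eqType} n (l : seq T)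
    (F : T -> ('I_s -> R) -> R) M :
  (forall x, x \in l -> majn n (F x) M) ->
  majn n (fun y => \sum_(x <- l) F x y) (fun w => (size l)%:R * M w).
Proof.
elim: l => [|x l IH] FM.
  have -> : (fun y => \sum_(x <- [::]) F x y) = fun=> 0.
    by apply/funext => y; rewrite big_nil.
  by apply: majn_cst => [|w]; rewrite mul0r ?normr0.
have -> : (fun y => \sum_(x <- x :: l) F x y) = fun y => F x y + \sum_(x <- l) F x y.
  by apply/funext => y; rewrite big_cons.
have h1 := FM x (mem_head _ _).
have h2 := IH (fun z zl => FM z (mem_behead (s := x :: l) zl)).
apply: majn_le (majn_add h1 h2) => w.
by rewrite /= -[(size l).+1]addn1 natrD mulrDl mul1r addrC.
Qed.

(** * Substitution of sinusoids *)

(** Each factor is stored as a coordinate and a phase: differentiating a cosine only advances its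
    phase by [pi / 2], so this class of products is stable up to sums and powers of [2 * pi]. *)
Definition trig {R : realType} {s : nat} (e : seq ('I_s * R)) (y : 'I_s -> R) : R :=
  \prod_(p <- e) cos (2 * pi * y p.1 + p.2).

(** The terms of the product rule in direction [j], without their common factor [2 * pi]. *)
Fixpoint trig_var {R : realType} {s : nat} (j : 'I_s) (e : seq ('I_s * R)) :
    seq (seq ('I_s * R)) :=
  if e is p :: e' then
    (if p.1 == j then [:: (p.1, p.2 + pi / 2) :: e'] else [::])
      ++ [seq p :: e'' | e'' <- trig_var j e']
  else [::].

Definition deg {R : realType} {s : nat} (e : seq ('I_s * R)) (i : 'I_s) : nat :=
  count (fun p => p.1 == i) e.

Lemma size_trig_var {R : realType} {s : nat} (j : 'I_s) (e : seq ('I_s * R)) :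
  size (trig_var j e) = deg e j.
Proof.
by elim: e => [//|p e IH] /=; rewrite size_cat size_map IH; case: eqP.
Qed.

Lemma deg_trig_var {R : realType} {s : nat} (j : 'I_s) (e e' : seq ('I_s * R)) :
  e' \in trig_var j e -> deg e' = deg e.
Proof.
elim: e e' => [//|p e IH] e' /=; rewrite mem_cat => /orP[|/mapP[e2 /IH e2E ->]].
  by case: ifP => // _; rewrite inE => /eqP ->.
by apply/funext => i; rewrite /deg /= -/(deg e2 i) e2E.
Qed.

Lemma is_derive_trig1 {R : realType} (c x : R) :
  is_derive x (1 : R) (fun x => cos (2 * pi * x + c)) (2 * pi * cos (2 * pi * x + (c + pi / 2))).
Proof.
have h : is_derive x (1 : R) (fun x : R => 2 * pi * x + c) (2 * pi).
  have -> : (fun x : R => 2 * pi * x + c) = (2 * pi) \*: (id : R -> R) + cst c by [].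
  by apply: is_derive_eq; rewrite addr0 /GRing.scale/= mulr1.
have := @is_derive1_comp R cos _ x _ _ (is_derive_cos _) h.
by move=> h'; apply: is_derive_eq h' _; rewrite addrA cosDpihalf mulrC.
Qed.

Lemma is_derive_sin2pi {R : realType} (x : R) :
  is_derive x (1 : R) (fun x => sin (2 * pi * x)) (2 * pi * cos (2 * pi * x)).
Proof.
have := is_derive_trig1 (- (pi / 2)) x; rewrite addNr addr0.
by congr is_derive; apply/funext => t; rewrite cosBpihalf.
Qed.

Lemma is_pderiv_trig {R : realType} {s : nat} (j : 'I_s) (e : seq ('I_s * R)) :
  is_pderiv j (trig e) (fun y => 2 * pi * \sum_(e' <- trig_var j e) trig e' y).
Proof.
elim: e => [|p e IH].
  have -> : trig [::] = (fun=> 1) :> (('I_s -> R) -> R).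
    by apply/funext => y; rewrite /trig big_nil.
  by move=> y; have := is_pderiv_cst j 1 y; rewrite big_nil mulr0.
have -> : trig (p :: e) = (fun y => cos (2 * pi * y p.1 + p.2) * trig e y).
  by apply/funext => y; rewrite /trig big_cons.
move=> y; have := is_pderivM (is_pderiv_comp (is_derive_trig1 p.2) (is_pderiv_coord j p.1)) IH y.
move=> h; apply: is_derive_eq h _ => /=.
rewrite big_cat big_map /= [RHS]mulrDr; congr (_ + _).
  case: eqP => _; last by rewrite big_nil !mulr0 mul0r.
  by rewrite big_seq1 /trig big_cons /= mulr1 mulrA.
rewrite mulrCA mulr_sumr; congr (_ * _); apply: eq_bigr => e2 _.
by rewrite /trig big_cons.
Qed.

Lemma is_pderiv_sin {R : realType} {s : nat} (j : 'I_s) (g g' : ('I_s -> R) -> R) :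
  is_pderiv j g g' ->
  is_pderiv j (fun y => g (fun i => sin (2 * pi * y i)))
    (fun y => 2 * pi * (cos (2 * pi * y j) * g' (fun i => sin (2 * pi * y i)))).
Proof.
move=> gg y; have h := gg (fun i => sin (2 * pi * y i)).
have := @is_derive1_comp R _ (fun t => sin (2 * pi * t)) (y j) _ _ h (is_derive_sin2pi _).
set F := _ \o _; have -> : F = fun t => g (fun i => sin (2 * pi * if i == j then t else y i)).
  by apply/funext => t; rewrite /F /=; congr g; apply/funext => k; case: eqP.
by move=> h'; apply: is_derive_eq h' _; ring.
Qed.

Definition incr {s : nat} (j : 'I_s) (m : 'I_s -> nat) (i : 'I_s) : nat := ((i == j) + m i)%N.

(* Differentiating a product of [sum_j m_j] sinusoids times an [m]-th partial
   derivative of [g] evaluated at [sin (2 pi y)] either hits one of the [m_j]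
   sinusoids in [y_j], or raises the order of the derivative of [g]. *)
Fixpoint sin_bound {R : realType} {s : nat} (b : ('I_s -> nat) -> R) (m : 'I_s -> nat)
    (w : seq 'I_s) : R :=
  if w is j :: w' then
    2 * pi * ((m j)%:R * sin_bound b m w' + sin_bound b (incr j m) w')
  else b m.

Lemma norm_trig_le1 {R : realType} {s : nat} (e : seq ('I_s * R)) y : `|trig e y| <= 1.
Proof.
rewrite /trig normr_prod; elim: e => [|p e IH]; first by rewrite big_nil.
by rewrite big_cons; apply: mulr_ile1 => //; [exact: prodr_ge0 | exact: cos_max].
Qed.

(** Here [g] plays the role of an outer derivative of order [deg e]: every differentiation of the
    outer function also creates one sinusoid, so a single multiindex records both. The hypothesis on
    [N] says that further directions [u] raise this order by their multiplicities. *)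
Lemma majn_sin {R : realType} {s : nat} n (b : ('I_s -> nat) -> R) (g : ('I_s -> R) -> R)
    (e : seq ('I_s * R)) N :
  majn n g N -> (forall u, N u = b (fun i => (deg e i + count_mem i u)%N)) ->
  majn n (fun y => trig e y * g (fun i => sin (2 * pi * y i))) (sin_bound b (deg e)).
Proof.
elim: n g e N => [//|n IH] g e N gN NE; have gN' := majnW gN; have [g0 gj] := gN.
have NE0 : N [::] = b (deg e).
  by rewrite NE; congr b; apply/funext => i; rewrite addn0.
split=> [y|j].
  rewrite /= -NE0 normrM.
  by apply: le_trans (ler_piMl _ (norm_trig_le1 _ _)) (g0 _).
have [g' gg gM] := gj j.
set sn := fun (y : 'I_s -> R) (i : 'I_s) => sin (2 * pi * y i).
(* The new factor [(j, 0)] is the cosine coming from the inner function [sin (2 * pi * y j)]. *)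
exists (fun y => 2 * pi * (\sum_(e' <- trig_var j e) (trig e' y * g (sn y))
   + trig ((j, 0) :: e) y * g' (sn y))).
  move=> y; have := is_pderivM (is_pderiv_trig j e) (is_pderiv_sin gg) y.
  move=> h; apply: is_derive_eq h _ => /=.
  rewrite [RHS]mulrDr -mulr_suml; congr (_ + _); first by rewrite mulrA.
  by rewrite /trig big_cons /= addr0 -/(trig e y); ring.
apply: majn_scale; first by rewrite mulr_ge0// pi_ge0.
have degE : deg ((j, 0 : R) :: e) = incr j (deg e).
  by apply/funext => i; rewrite /deg /incr /= eq_sym.
apply: majn_add.
  rewrite -size_trig_var; apply: majn_sum_seq => e' e'j.
  have de := deg_trig_var e'j; rewrite -de; apply: IH gN' _ => u.
  by rewrite NE de.
rewrite -degE; apply: IH gM _ => u; rewrite NE; congr b; apply/funext => i.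
by rewrite degE /incr /= (eq_sym j) addnCA addnA.
Qed.

(** * Stirling numbers *)

Lemma stirling2_rec {R : realType} n k :
  stirling2 R n.+1 k.+1 = k.+1%:R * stirling2 R n k.+1 + stirling2 R n k.
Proof.
(* [T n k] is [k! S(n,k)] without the cutoff at [k > n]. The recursion is proved for [T], and with
   [T 0 l.+1 = (1 - 1)^(l+1) = 0] it shows that the cutoff changes nothing. *)
pose T n k : R := \sum_(i < k.+1) (-1) ^+ (k - i) * 'C(k, i)%:R * i%:R ^+ n.
have TS m l : T m.+1 l.+1 = l.+1%:R * T m l.+1 + l.+1%:R * T m l.
  apply/eqP; rewrite -subr_eq0; apply/eqP.
  (* The added term [i = l + 1] has a zero binomial coefficient, so both sums in the recursion run
     over the same range. *)
  have -> : T m l = - \sum_(i < l.+2) (-1) ^+ (l.+1 - i) * 'C(l, i)%:R * i%:R ^+ m.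
    rewrite big_ord_recr /= bin_small// mulr0 mul0r addr0 -sumrN.
    by apply: eq_bigr => i _; rewrite subSn ?leq_ord// exprS mulN1r !mulNr opprK.
  rewrite mulrN !mulr_sumr opprB addrCA -sumrB -big_split /=.
  apply: big1 => i _.
  have : (l.+1 - i)%:R * 'C(l.+1, i)%:R = l.+1%:R * 'C(l, i)%:R :> R.
    by rewrite -!natrM mul_bin_down.
  rewrite natrB ?leq_ord// => h.
  have -> : l.+1%:R * ((-1) ^+ (l.+1 - i) * 'C(l, i)%:R * i%:R ^+ m) =
     (-1) ^+ (l.+1 - i) * i%:R ^+ m * (l.+1%:R * 'C(l, i)%:R) :> R by ring.
  by rewrite -h exprS; ring.
have T0 l : T 0%N l.+1 = 0.
  have := exprDn (-1 : R) 1 l.+1; rewrite addNr expr0n /= => h; rewrite [RHS]h.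
  by apply: eq_bigr => i _; rewrite expr1n mulr1 expr0 mulr1 mulr_natr.
have Tlt m l : (m < l)%N -> T m l = 0.
  elim: m l => [|m IH] [|l] //; rewrite ltnS => ml.
  by rewrite TS !IH ?mulr0 ?addr0// ltnS ltnW.
have SE m l : stirling2 R m l = (l`!%:R)^-1 * T m l.
  by rewrite /stirling2; case: leqP => // /Tlt ->; rewrite mulr0.
have f0 m : m`!%:R != 0 :> R by rewrite pnatr_eq0 -lt0n fact_gt0.
have k0 : k.+1%:R != 0 :> R by rewrite pnatr_eq0.
rewrite !SE TS factS natrM; field.
by rewrite ?f0 ?nat1r ?k0.
Qed.

Lemma stirling2_small {R : realType} n k : (n < k)%N -> stirling2 R n k = 0.
Proof. by move=> nk; rewrite /stirling2 leqNgt nk. Qed.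

Lemma stirling2_0 {R : realType} n : stirling2 R n 0 = (n == 0%N)%:R.
Proof. by rewrite /stirling2 /= big_ord1 subnn bin0 fact0 invr1 !mul1r expr0n. Qed.

(** Counts the ways in which [n] differentiations in [y_j] reach order [i]. The range ends at a free
    [N] because [S(n,i) = 0] for [i > n]; this later gives all coordinates the same index type. *)
Lemma sin_bound_nseq {R : realType} {s : nat} (b : ('I_s -> nat) -> R) (m : 'I_s -> nat)
    (j : 'I_s) n N w :
  (n <= N)%N -> m j = 0%N ->
  sin_bound b m (nseq n j ++ w) =
  (2 * pi) ^+ n * \sum_(i < N.+1)
    stirling2 R n i * sin_bound b (fun k => if k == j then i : nat else m k) w.
Proof.
move=> nN mj; elim: n nN w => [|n IH] nN w.
  rewrite big_ord_recl big1 ?addr0 => [|i _]; last by rewrite stirling2_small ?mul0r.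
  rewrite stirling2_0 !mul1r /=; congr sin_bound.
  by apply/funext => k; case: eqP => [->|].
have -> : nseq n.+1 j ++ w = nseq n j ++ (j :: w) by rewrite -[n.+1]addn1 nseqD -catA.
rewrite IH ?(ltnW nN)// exprSr -mulrA; congr (_ * _).
pose f (i : nat) := sin_bound b (fun k => if k == j then i else m k) w.
(* The last letter [j] is consumed by unfolding [sin_bound] once; collecting the coefficient of each
   [f i] leaves the Stirling recursion. *)
transitivity (2 * pi * \sum_(i < N.+1) stirling2 R n i * (i%:R * f i + f i.+1)).
  rewrite [RHS]mulr_sumr; apply: eq_bigr => i _ /=; rewrite eqxx mulrCA.
  congr (_ * (_ * (_ + _))); rewrite /f; congr sin_bound.
  by apply/funext => k; rewrite /incr; case: eqP.
congr (_ * _); rewrite -/f.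
transitivity (\sum_(i < N.+1) stirling2 R n i * i%:R * f i +
  \sum_(i < N.+1) stirling2 R n i * f i.+1).
  by rewrite -big_split; apply: eq_bigr => i _; rewrite mulrDr mulrA.
(* The shift of index loses nothing: the first sum vanishes at [i = 0], the second at [i = N] since
   [n < N]. *)
rewrite big_ord_recl mulr0 mul0r add0r [X in _ + X]big_ord_recr /=.
rewrite stirling2_small// mul0r addr0 -big_split /=.
rewrite [RHS]big_ord_recl stirling2_0 mul0r add0r; apply: eq_bigr => i _.
by rewrite /= -/(f _) stirling2_rec /bump leq0n add1n; ring.
Qed.

(* [pderivn] applies the derivatives in the last directions of [l] first. *)
Definition word {s : nat} (nu : 'I_s -> nat) (l : seq 'I_s) : seq 'I_s :=
  foldr (fun j w => w ++ nseq (nu j) j) [::] l.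

(** One coordinate is treated at a time: the multiindices vanish outside the coordinates already in
    [l], so each new block [nseq (nu j) j] starts from order [0] in [y_j]. *)
Lemma sin_bound_word {R : realType} {s : nat} (b : ('I_s -> nat) -> R) (nu : 'I_s -> nat)
    N l w :
  (forall j, nu j <= N)%N -> uniq l ->
  sin_bound b (fun=> 0%N) (word nu l ++ w) =
  (2 * pi) ^+ (\sum_(j <- l) nu j) *
    \sum_(m : {ffun 'I_s -> 'I_N.+1} | [forall j, (j \notin l) ==> (m j == ord0)])
      \prod_(j <- l) stirling2 R (nu j) (m j) * sin_bound b (fun j => m j : nat) w.
Proof.
move=> nuN; elim: l w => [|j l IH] w /=.
  rewrite big_nil expr0 mul1r (big_pred1 [ffun=> ord0]) => [_|m].
    by rewrite big_nil mul1r; congr sin_bound; apply/funext => j; rewrite ffunE.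
  apply/forallP/eqP => [m0|-> j]; last by rewrite ffunE eqxx.
  by apply/ffunP => j; rewrite ffunE; apply/eqP; exact: m0.
move=> /andP[jl ul]; rewrite -catA IH// big_cons addnC exprD -mulrA; congr (_ * _).
pose up (m : {ffun 'I_s -> 'I_N.+1}) (i : 'I_N.+1) := [ffun k => if k == j then i else m k].
pose F (m : {ffun 'I_s -> 'I_N.+1}) :=
  \prod_(k <- j :: l) stirling2 R (nu k) (m k) * sin_bound b (fun k => m k : nat) w.
pose P (m : {ffun 'I_s -> 'I_N.+1}) := [forall k, (k \notin l) ==> (m k == ord0)].
transitivity ((2 * pi) ^+ nu j * \sum_(m | P m) \sum_(i < N.+1) F (up m i)).
  rewrite mulr_sumr; apply: eq_bigr => m /forallP /(_ j); rewrite jl => /eqP mj.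
  rewrite (@sin_bound_nseq _ _ _ _ _ _ N)// ?mj// mulrCA; congr (_ * _).
  rewrite mulr_sumr; apply: eq_bigr => i _; rewrite /F big_cons ffunE eqxx mulrCA mulrA.
  congr (_ * _ * _); last by congr sin_bound; apply/funext => k; rewrite ffunE; case: eqP.
  apply: eq_big_seq => k kl; rewrite ffunE; case: eqP => // kj.
  by move: jl; rewrite -kj kl.
congr (_ * _); rewrite pair_big_dep /=.
(* A multiindex supported on [j :: l] corresponds to its value at [j] together with the multiindex
   obtained by resetting that value to [0]. *)
rewrite (reindex_onto (fun m => (up m ord0, m j)) (fun p => up p.1 p.2)) /=; last first.
  move=> [m i] /= /andP[/forallP /(_ j)]; rewrite jl => /eqP mj _; congr (_, _).
    by apply/ffunP => k; rewrite !ffunE; case: eqP => // ->.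
  by rewrite ffunE eqxx.
have upK (m : {ffun 'I_s -> 'I_N.+1}) : up (up m ord0) (m j) = m.
  by apply/ffunP => k; rewrite !ffunE; case: eqP => // ->.
apply: eq_big => [m|m _]; last by rewrite upK.
rewrite upK eqxx !andbT; apply/forallP/forallP => h k; have := h k.
  by rewrite ffunE inE negb_or; case: (k == j).
by rewrite ffunE inE negb_or; case: (k == j); rewrite ?eqxx ?implybT.
Qed.

Lemma sin_bound_enum {R : realType} {s : nat} (b : ('I_s -> nat) -> R) (nu : 'I_s -> nat) :
  sin_bound b (fun=> 0%N) (word nu (enum 'I_s)) =
  (2 * pi) ^+ mabs nu *
    \sum_(m : {ffun 'I_s -> 'I_(mabs nu).+1} | [forall j, (m j <= nu j)%N])
      b (fun j => m j : nat) * mstirling R nu (fun j => m j : nat).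
Proof.
rewrite -[word _ _]cats0 (@sin_bound_word _ _ _ _ (mabs nu)) ?enum_uniq//; last first.
  by move=> j; rewrite /mabs (bigD1 j)//= leq_addr.
rewrite big_enum /=; congr (_ * _); rewrite big_mkcond [RHS]big_mkcond /=.
apply: eq_bigr => m _; rewrite big_enum -/(mstirling R nu (fun j => m j)) /=.
have -> : [forall j, (j \notin enum 'I_s) ==> (m j == ord0)].
  by apply/forallP => j; rewrite mem_enum.
case: forallP => [_|h]; first by rewrite mulrC.
(* A multiindex not below [nu] contributes nothing, one of its Stirling factors being zero. *)
have /existsP[j] : [exists j, ~~ (m j <= nu j)%N] by rewrite -negb_forall; apply/forallP.
by rewrite -ltnNge /mstirling => mj; rewrite (bigD1 j)//= stirling2_small// !mul0r.
Qed.

(** * Multiindices as words of directions *)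

Lemma pderivnE {R : realType} {s : nat} (nu : 'I_s -> nat) (f : ('I_s -> R) -> R) :
  pderivn nu f = foldl (fun g j => pderiv j g) f (word nu (enum 'I_s)).
Proof.
rewrite /pderivn; elim: (enum 'I_s) => [//|j l IH] /=.
rewrite IH foldl_cat; move: (foldl _ f _) => g.
by elim: (nu j) g => [//|n IHn] g; rewrite iterSr IHn.
Qed.

Lemma count_word {s : nat} (nu : 'I_s -> nat) l i :
  uniq l -> count_mem i (word nu l) = ((i \in l) * nu i)%N.
Proof.
elim: l => [//|j l IH] /= /andP[jl ul].
rewrite count_cat IH// count_nseq in_cons /= (eq_sym j).
by case: eqP => [->|_]; rewrite ?(negbTE jl) ?mul0n ?mul1n ?addn0.
Qed.

Lemma sin_boundZ {R : realType} {s : nat} (c : R) (b : ('I_s -> nat) -> R) m w :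
  sin_bound (fun u => c * b u) m w = c * sin_bound b m w.
Proof. by elim: w m => [//|j w IH] m /=; rewrite !IH; ring. Qed.

Lemma sin_bound_ge0 {R : realType} {s : nat} (b : ('I_s -> nat) -> R) m w :
  (forall u, 0 <= b u) -> 0 <= sin_bound b m w.
Proof.
move=> b0; elim: w m => [|j w IH] m /=; first exact: b0.
by rewrite mulr_ge0 ?addr_ge0 ?mulr_ge0 ?pi_ge0.
Qed.

(** The derivative of order [m] at the origin of [1 / (1 - S * sum_j beta_j y_j)]. *)
Definition fact_mpow {R : realType} {s : nat} (S : R) (beta : nat -> R) (m : 'I_s -> nat) : R :=
  (mabs m)`!%:R * mpow S beta m.

Lemma fact_mpow_ge0 {R : realType} {s : nat} (S : R) (beta : nat -> R) (m : 'I_s -> nat) :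
  0 <= S -> (forall j, 0 < beta j) -> 0 <= fact_mpow S beta m.
Proof.
move=> S0 b0; rewrite mulr_ge0// prodr_ge0// => j _.
by rewrite exprn_ge0// mulr_ge0// ltW.
Qed.

Lemma fact_mpow_count {R : realType} {s : nat} (S : R) (beta : nat -> R) (u : seq 'I_s) :
  fact_mpow S beta (fun i => count_mem i u) =
  (size u)`!%:R * (S ^+ size u * \prod_(j <- u) beta j).
Proof.
rewrite /fact_mpow /mabs /mpow; congr (_`!%:R * _).
  elim: u => [|j u IH] /=; first by rewrite big1.
  rewrite big_split /= IH (bigD1 j)//= eqxx big1 ?addn0// => i /negbTE.
  by rewrite eq_sym => ->.
elim: u => [|j u IH] /=; first by rewrite big_nil mul1r big1.
under eq_bigr do rewrite exprD.
rewrite big_split /= IH (bigD1 j)//= eqxx expr1 big1 => [|i]; last first.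
  by rewrite eq_sym => /negbTE ->; rewrite expr0.
by rewrite big_cons exprS; ring.
Qed.

(** Passing from [(n+1)! S^n] to [(n+1)! S^(n+1)] costs a division by [S], the origin of the
    quotient [P / S] in [Cl]. *)
Lemma wt_geom2 {R : realType} {s : nat} (P S : R) (beta : nat -> R) (j : 'I_s) u :
  S != 0 ->
  beta j * P * wt (fun i : 'I_s => beta i) (egf_geom S ^+ 2) u =
  P / S * fact_mpow S beta (fun i => count_mem i (j :: u)).
Proof.
by move=> S0; rewrite fact_mpow_count /wt egf_geom2E big_cons /= exprS; field.
Qed.

(** * Networks *)

Lemma net_sin {R : realType} (sigma : R -> R) (s : nat) (d : nat -> nat)
    (W : nat -> nat -> nat -> R) (v : nat -> nat -> R) l y p :
  net R (fun x => sin (2 * pi * x)) sigma s d W v l y p =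
  net R id sigma s d W v l (fun i => sin (2 * pi * y i)) p.
Proof.
by elim: l p => [//|l IH] p /=; congr (_ + _); apply: eq_bigr => q _; rewrite IH.
Qed.

Lemma Pk_gt0 {R : realType} (xi tau : R) (Rl : nat -> R) k :
  0 < xi -> 0 < tau -> (forall l, (1 <= l)%N -> 0 < Rl l) -> 0 < Pk xi tau Rl k.
Proof.
move=> xi0 tau0 R0; rewrite /Pk big_nat; apply: prodr_gt0 => t /andP[t1 _].
by rewrite !mulr_gt0 ?R0.
Qed.

Lemma PkS {R : realType} (xi tau : R) (Rl : nat -> R) k :
  Pk xi tau Rl k.+1 = Pk xi tau Rl k * (xi * tau * Rl k.+1).
Proof. by rewrite /Pk big_nat_recr. Qed.

Lemma SlS {R : realType} (xi tau : R) (Rl : nat -> R) k :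
  Sl xi tau Rl k.+1 = Sl xi tau Rl k + tau * Pk xi tau Rl k.
Proof. by rewrite /Sl big_nat_recr// mulrDr. Qed.

Lemma Sl_ge0 {R : realType} (xi tau : R) (Rl : nat -> R) k :
  0 < xi -> 0 < tau -> (forall l, (1 <= l)%N -> 0 < Rl l) -> 0 <= Sl xi tau Rl k.
Proof.
move=> xi0 tau0 R0; apply: mulr_ge0; [exact: ltW | apply: sumr_ge0 => i _].
by rewrite ltW// Pk_gt0.
Qed.

Lemma is_derive_derive1n {R : realType} (sigma : R -> R) k (x : R) :
  (forall n x, derivable (derive1n n sigma) x 1) ->
  is_derive x (1 : R) (derive1n k sigma) (derive1n k.+1 sigma x).
Proof. by move=> ds; rewrite derive1nS derive1E; exact/derivableP. Qed.

(** Only first derivatives are majorised, by [P / (1 - S t)^2], because the weights and [sigma]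
    control increments of the network and not its values. The bounds hold on the whole space, so
    they also apply at the points [sin (2 pi y)], which may leave the cube. *)
Lemma net_majn {R : realType} (s L : nat) (d : nat -> nat) (W : nat -> nat -> nat -> R)
    (v : nat -> nat -> R) (sigma : R -> R) (beta Rl : nat -> R) (xi tau : R) :
  (forall n x, derivable (derive1n n sigma) x 1) ->
  (forall j, 0 < beta j) -> (forall l, (1 <= l)%N -> 0 < Rl l) ->
  0 < xi -> 0 < tau ->
  (forall p j, (p < d 1%N)%N -> (j < s)%N -> `|W 0%N p j| <= beta j) ->
  (forall l, (1 <= l <= L)%N -> forall p, (p < d l.+1)%N ->
     \sum_(q < d l) `|W l p q| <= Rl l) ->
  (forall n x, (1 <= n)%N -> `|derive1n n sigma x| <= xi * tau ^+ n * n`!%:R) ->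
  forall l p n (j : 'I_s), (l <= L)%N -> (p < d l.+1)%N ->
  exists2 g, is_pderiv j (fun z => net R id sigma s d W v l z p) g &
    majn n g (fun w => beta j * Pk xi tau Rl l *
      wt (fun i : 'I_s => beta i) (egf_geom (Sl xi tau Rl l) ^+ 2) w).
Proof.
move=> ds b0 R0 xi0 tau0 W0 WR sb.
have wt_ge0 S w : 0 <= S -> 0 <= wt (fun i : 'I_s => beta i) (egf_geom S ^+ 2) w.
  move=> S0; rewrite mulr_ge0 ?egf_geom2E ?mulr_ge0 ?exprn_ge0//.
  by apply: prodr_ge0 => i _; exact: ltW.
elim=> [|l IH] p n j lL pd.
  exists (fun=> W 0%N p j).
    move=> y; have := is_pderivD (is_pderiv_sum (fun q : 'I_s => W 0%N p q)
      (fun q => is_pderiv_coord j q)) (is_pderiv_cst j (v 0%N p)) y.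
    move=> h; apply: is_derive_eq h _.
    rewrite addr0 (bigD1 j)//= eqxx mulr1 big1 ?addr0// => i /negbTE ->.
    by rewrite mulr0.
  (* For the affine layer the majorant is [u = t]: its first derivative is constant. *)
  have P1 : Pk xi tau Rl 0 = 1 by rewrite /Pk big_geq.
  have S0 : Sl xi tau Rl 0 = 0 by rewrite /Sl big_geq// mulr0.
  rewrite P1 S0; apply: majn_cst => [|w].
    by rewrite /wt big_nil egf_geom2E expr0 factS fact0 !mulr1 W0.
  by apply: mulr_ge0; [rewrite mulr1 ltW | exact: wt_ge0].
set P := Pk xi tau Rl l; set S := Sl xi tau Rl l.
have P0 : 0 < P by exact: Pk_gt0.
have fj q i : (q < d l.+1)%N -> exists2 g,
    is_pderiv i (fun z => net R id sigma s d W v l z q) g &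
    majn n g (fun w => beta i * P * wt (fun i : 'I_s => beta i) (egf_geom S ^+ 2) w).
  by move=> qd; apply: IH => //; exact: ltnW.
have gj (q : 'I_(d l.+1)) : exists g,
    is_pderiv j (fun z => sigma (net R id sigma s d W v l z q)) g /\
    majn n g (fun w => xi * tau * (beta j * P) *
       wt (fun i : 'I_s => beta i) (egf_geom (S + tau * P) ^+ 2) w).
  have [g fg gM] := fj q j (ltn_ord q).
  exists (fun y => derive1n 1 sigma (net R id sigma s d W v l y q) * g y); split.
    exact: (is_pderiv_comp (fun x => is_derive_derive1n 0 x ds) fg).
  have := majn_comp (sg := fun k => derive1n k sigma) (fun k x => is_derive_derive1n k x ds) sb
    (fun i => fj q i (ltn_ord q)) (leqnn 1).
  (* The bound for [sigma'] carries the square of the ratio, which cancels against [egf_geom S ^+ 2]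
     and leaves the geometric series with parameter [S + tau * P]. *)
  move=> h; apply: majn_le (majn_mul h gM) => w.
  by rewrite -exprMn egf_ratio_geom expr1 factS fact0 mulr1.
have [g gP] := choice gj.
exists (fun y => \sum_(q < d l.+1) W l.+1 p q * g q y).
  move=> y; have := is_pderivD (is_pderiv_sum (fun q : 'I_(d l.+1) => W l.+1 p q)
    (fun q => (gP q).1)) (is_pderiv_cst j (v l.+1 p)) y.
  by rewrite addr0.
apply: majn_le (majn_sum (fun q => (gP q).2) (WR _ _ _ pd) _) => [w||w] //.
  by rewrite PkS SlS -/P -/S le_eqVlt; apply/orP; left; apply/eqP; ring.
apply: mulr_ge0; first by apply: ltW; rewrite !mulr_gt0.
by apply: wt_ge0; apply: addr_ge0; [exact: Sl_ge0 | apply: ltW; rewrite mulr_gt0].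
Qed.

(** * Boundedness of the networks on the cube *)

Lemma sublinear_sigma {R : realType} (sigma : R -> R) (C : R) :
  (forall x, derivable sigma x 1) -> (forall x, `|derive1 sigma x| <= C) ->
  forall x, `|sigma x| <= `|sigma 0| + C * `|x|.
Proof.
move=> ds sC x.
have lip (a b : R) : a <= b -> `|sigma b - sigma a| <= C * `|b - a|.
  move=> ab; have [||c _ ->] := @MVT_segment R sigma (derive1 sigma) a b ab.
  - by move=> z _; rewrite derive1E; exact/derivableP.
  - by apply: derivable_within_continuous => z _.
  - by rewrite normrM ler_wpM2r.
rewrite -lerBlDl; apply: le_trans (lerB_dist _ _) _.
have [x0|/ltW x0] := leP 0 x; first by have := lip _ _ x0; rewrite subr0.
by have := lip _ _ x0; rewrite distrC sub0r normrN.
Qed.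

(** Linear growth of [sigma] carries bounds from layer to layer. This makes the set in [net_sup]
    bounded above, without which its [sup] would not dominate the values. *)
Lemma net_bounded {R : realType} (inp sigma : R -> R) (s : nat) (d : nat -> nat)
    (W : nat -> nat -> nat -> R) (v : nat -> nat -> R) (C : R) :
  (forall x, 0 <= x <= 1 -> `|inp x| <= 1) -> 0 <= C ->
  (forall x, `|sigma x| <= `|sigma 0| + C * `|x|) ->
  forall l p, exists B, forall y, unit_cube R s y -> `|net R inp sigma s d W v l y p| <= B.
Proof.
move=> inp1 C0 sC; elim=> [|l IH] p.
  exists (\sum_(q < s) `|W 0%N p q| + `|v 0%N p|) => y y1 /=.
  apply: le_trans (ler_normD _ _) _; rewrite lerD2r.
  apply: le_trans (ler_norm_sum _ _ _) _; apply: ler_sum => q _.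
  by rewrite normrM ler_piMr// inp1// y1.
have [B BP] := choice IH.
exists (\sum_(q < d l.+1) `|W l.+1 p q| * (`|sigma 0| + C * B q) + `|v l.+1 p|) => y y1 /=.
apply: le_trans (ler_normD _ _) _; rewrite lerD2r.
apply: le_trans (ler_norm_sum _ _ _) _; apply: ler_sum => q _.
rewrite normrM ler_wpM2l//; apply: le_trans (sC _) _.
by rewrite lerD2l ler_wpM2l// BP.
Qed.

Lemma le_net_sup {R : realType} (inp sigma : R -> R) (s : nat) (d : nat -> nat)
    (W : nat -> nat -> nat -> R) (v : nat -> nat -> R) l p y :
  (forall p, exists B, forall y, unit_cube R s y -> `|net R inp sigma s d W v l y p| <= B) ->
  (p < d l.+1)%N -> unit_cube R s y ->
  `|net R inp sigma s d W v l y p| <= net_sup inp sigma s d W v l.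
Proof.
move=> /choice[B BP] pd y1; apply: ub_le_sup; last by exists y => //; exists p.
(* Finitely many components: the sum of their bounds serves for all of them. *)
exists (\sum_(q < d l.+1) `|B q|) => _ [z z1 [q qd <-]].
apply: le_trans (BP q z z1) _; apply: le_trans (ler_norm _) _.
by rewrite (bigD1 (Ordinal qd))//= lerDl sumr_ge0.
Qed.

Theorem theorem2p2 (R : realType) (s L : nat) (d : nat -> nat)
  (W : nat -> nat -> nat -> R) (v : nat -> nat -> R) (sigma : R -> R)
  (beta Rl : nat -> R) (xi tau : R) :
  (1 <= s)%N -> (1 <= L)%N -> d 0%N = s ->
  (forall n x, derivable (derive1n n sigma) x 1) ->
  (forall j, 0 < beta j) -> (forall l, (1 <= l)%N -> 0 < Rl l) ->
  0 < xi -> 0 < tau ->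
  (forall p j, (p < d 1%N)%N -> (j < s)%N -> `|W 0%N p j| <= beta j) ->
  (forall l, (1 <= l <= L)%N -> forall p, (p < d l.+1)%N ->
     \sum_(q < d l) `|W l p q| <= Rl l) ->
  (forall n x, (1 <= n)%N -> `|derive1n n sigma x| <= xi * tau ^+ n * n`!%:R) ->
  forall l, (1 <= l <= L)%N -> forall p, (p < d l.+1)%N ->
  forall nu : 'I_s -> nat, forall y, unit_cube R s y ->
    (`|pderivn nu (fun z => net R id sigma s d W v l z p) y|
       <= Cl id sigma s d W v xi tau Rl l * (mabs nu)`!%:R
          * mpow (Sl xi tau Rl l) beta nu)
    /\
    (`|pderivn nu (fun z => net R (fun x => sin (2 * pi * x)) sigma s d W v l z p) y|
       <= Cl (fun x => sin (2 * pi * x)) sigma s d W v xi tau Rl l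
          * (2 * pi) ^+ (mabs nu)
          * \sum_(m : {ffun 'I_s -> 'I_(mabs nu).+1} | [forall j, (m j <= nu j)%N])
              ((mabs (fun j => nat_of_ord (m j)))`!%:R
               * mpow (Sl xi tau Rl l) beta (fun j => nat_of_ord (m j))
               * mstirling R nu (fun j => nat_of_ord (m j)))).
Proof.
move=> _ _ _ ds b0 R0 xi0 tau0 W0 WR sb l /andP[l1 lL] p pd nu y y1.
have P0 := Pk_gt0 l xi0 tau0 R0.
(* Here [1 <= l] matters: [Sl] is an empty sum at [l = 0]. *)
have S0 : 0 < Sl xi tau Rl l.
  case: l l1 {lL pd P0} => [//|l] _; rewrite SlS ltr_wpDl ?Sl_ge0//.
  by rewrite mulr_gt0 ?Pk_gt0.
have nj n j := net_majn v ds b0 R0 xi0 tau0 W0 WR sb n j lL pd.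
move: P0 S0 nj; set P := Pk _ _ _ _; set S := Sl _ _ _ _ => P0 S0 nj.
have sub : forall x, `|sigma x| <= `|sigma 0| + xi * tau * `|x|.
  apply: sublinear_sigma => x; first exact: (ds 0%N).
  by have := sb 1%N x isT; rewrite factS fact0 expr1 mulr1.
have xt0 : 0 <= xi * tau by rewrite ltW// mulr_gt0.
set w := word nu (enum 'I_s).
have nuE : nu = fun i => count_mem i w.
  by apply/funext => i; rewrite count_word ?enum_uniq// mem_enum mul1n.
have f0 m : 0 <= fact_mpow S beta (m : 'I_s -> nat) by apply: fact_mpow_ge0 => //; exact: ltW.
have PSC inp : P / S <= Cl inp sigma s d W v xi tau Rl l by rewrite le_max lexx orbT.
have supC inp : (forall x, 0 <= x <= 1 -> `|inp x| <= 1) ->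
    `|net R inp sigma s d W v l y p| <= Cl inp sigma s d W v xi tau Rl l.
  move=> inp1; apply: le_trans (le_net_sup _ pd y1) _; last by rewrite le_max lexx.
  exact: net_bounded inp1 xt0 sub l.
have fm0 : fact_mpow S beta (fun i : 'I_s => 0%N) = 1.
  by have := fact_mpow_count S beta ([::] : seq 'I_s); rewrite big_nil fact0 expr0 !mulr1.
rewrite !pderivnE -/w; split.
  rewrite -mulrA -/(fact_mpow S beta nu) nuE.
  (* For [nu = 0] the supremum is used; otherwise the first direction is split off to reach the
     derivative bounded by [net_majn]. *)
  case: (w) => [|j u] /=.
    rewrite fm0 mulr1; apply: supC => x /andP[x0 x1].
    by rewrite ger0_norm.
  have [g fg gM] := nj (size u).+1 j; rewrite (is_pderivE fg).
  apply: le_trans (majn_foldl gM y) _; rewrite wt_geom2 ?gt_eqF//.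
  by rewrite ler_wpM2r.
have -> : Cl (fun x => sin (2 * pi * x)) sigma s d W v xi tau Rl l * (2 * pi) ^+ mabs nu *
    (\sum_(m : {ffun 'I_s -> 'I_(mabs nu).+1} | [forall j, (m j <= nu j)%N])
       (mabs (fun j => m j : nat))`!%:R * mpow S beta (fun j => m j : nat)
         * mstirling R nu (fun j => m j : nat)) =
    Cl (fun x => sin (2 * pi * x)) sigma s d W v xi tau Rl l *
      sin_bound (fact_mpow S beta) (fun=> 0%N) w.
  by rewrite sin_bound_enum mulrA.
case: (w) => [|j u] /=.
  by rewrite fm0 mulr1; apply: supC => x _; exact: sin_max.
have [g fg gM] := nj (size u).+1 j.
have -> : (fun z => net R (fun x => sin (2 * pi * x)) sigma s d W v l z p) =
    fun z => net R id sigma s d W v l (fun i => sin (2 * pi * z i)) p.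
  by apply/funext => z; exact: net_sin.
rewrite (is_pderivE (is_pderiv_sin fg)).
(* After one differentiation there is one sinusoid in [y_j] and an outer derivative of order one,
   the starting situation for [majn_sin]. *)
have -> : (fun y => 2 * pi * (cos (2 * pi * y j) * g (fun i => sin (2 * pi * y i)))) =
    fun y => 2 * pi * (trig [:: (j, 0)] y * g (fun i => sin (2 * pi * y i))).
  by apply/funext => z; rewrite /trig big_seq1 addr0.
have pi2 : 0 <= 2 * pi :> R by rewrite mulr_ge0// pi_ge0.
have bE t : beta j * P * wt (fun i : 'I_s => beta i) (egf_geom S ^+ 2) t =
    P / S * fact_mpow S beta (fun i => (deg [:: (j, 0%R : R)] i + count_mem i t)%N).
  rewrite wt_geom2 ?gt_eqF//; congr (_ * fact_mpow _ _ _).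
  by apply/funext => i; rewrite /deg /= addn0.
have h := majn_sin (b := fun m => P / S * fact_mpow S beta m) gM bE.
apply: le_trans (majn_foldl (majn_scale pi2 h) y) _.
have -> : deg [:: (j, 0 : R)] = incr j (fun=> 0%N).
  by apply/funext => i; rewrite /deg /incr /= eq_sym.
(* At order [0] there is no sinusoid to differentiate, so only the term with [incr j] survives in
   [sin_bound]. *)
rewrite sin_boundZ mul0r add0r mulrCA; apply: ler_wpM2r => //.
by rewrite mulr_ge0// sin_bound_ge0.
Qed.
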